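(* In the message-passing model with $k$ sites holding subgraphs of an undirected graph $G$ on $n$ vertices (edge duplication allowed), there is a randomized protocol that, with probability at least $0.99$, outputs a value $\tilde D$ with $D\le\tilde D\le D+2$, where $D$ is the diameter of $G$ (the maximum over pairs of vertices of their shortest-path distance), and that uses $O(kn^{3/2}\log^2 n)$ bits of communication.
   Context: Message-passing model: $k$ sites $P_1,\dots,P_k$, each holding a private input; two-way point-to-point channels between every pair of sites; at the end some site outputs the answer; cost is total bits exchanged. Graph setting: each site $P_i$ holds a subgraph $G_i\subseteq G$ on the common vertex set, and $G$ is the union of the $G_i$; ''edge duplication allowed'' means an edge may be held by several sites. Logarithms are base 2. *)

(* Defs.v *)
From mathcomp Require Import all_boot.
Set Implicit Arguments. Unset Strict Implicit. Unset Printing Implicit Defensive.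

Definition edge_set (n : nat) := {set 'I_n * 'I_n}.

Definition union_adj (n k : nat) (E : 'I_k -> edge_set n) : rel 'I_n :=
  fun u v => [exists i, ((u, v) \in E i) || ((v, u) \in E i)].

Definition walk_le (n : nat) (e : rel 'I_n) (d : nat) (u v : 'I_n) : Prop :=
  exists p : seq 'I_n, [/\ path e u p, last u p = v & size p <= d].

(* D is the diameter: every pair is at distance <= D, and some pair is
   at distance exactly D (no walk shorter than D).  This is the maximum
   over pairs of the shortest-path distance; for a disconnected graph
   no finite D satisfies it (diameter = infinity). *)
Definition is_diameter (n : nat) (e : rel 'I_n) (D : nat) : Prop :=
  (forall u v, walk_le e D u v) /\
  (exists u v, forall d, walk_le e d u v -> D <= d).

(* Message-passing protocols with private coins.                     *)
(* Execution is sequential: the site currently allowed to act        *)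
(* (initially [start]) looks at its own view (its input, its own     *)
(* random bits, and the list of messages it has sent/received) and   *)
(* either sends a bit string to some site (which then acts next) or  *)
(* halts and outputs a value.  A message m costs (size m).+1 bits    *)
(* (one extra bit accounts for message delimitation).                *)

(* an event in a site's view: (sent?, other party, message) *)
Definition event (k : nat) := (bool * 'I_k * seq bool)%type.

Inductive action (k : nat) :=
| Send of 'I_k & seq bool
| Halt of nat.

Record protocol (n k : nat) := Protocol {
  coin_len : nat;
  start : 'I_k;
  step : 'I_k -> edge_set n -> coin_len.-tuple bool -> seq (event k) -> action k
}.

Arguments coin_len {n k}.
Arguments start {n k}.
Arguments step {n k}.
Arguments Send {k}.
Arguments Halt {k}.

Definition coins (n k : nat) (P : protocol n k) :=
  {ffun 'I_k -> (coin_len P).-tuple bool}.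

Definition upd_view (k : nat) (views : 'I_k -> seq (event k)) (j : 'I_k)
  (ev : event k) : 'I_k -> seq (event k) :=
  fun x => if x == j then rcons (views x) ev else views x.

Fixpoint exec (n k : nat) (P : protocol n k) (E : 'I_k -> edge_set n)
  (r : coins P) (fuel : nat) (cur : 'I_k) (views : 'I_k -> seq (event k))
  (cost : nat) : option (nat * nat) :=
  match fuel with
  | 0 => None
  | fuel'.+1 =>
    match step P cur (E cur) (r cur) (views cur) with
    | Halt out => Some (out, cost)
    | Send j m =>
        let views1 := upd_view views cur (true, j, m) in
        let views2 := upd_view views1 j (false, cur, m) in
        @exec n k P E r fuel' j views2 (cost + (size m).+1)
    end
  end.

Definition run (n k : nat) (P : protocol n k) (E : 'I_k -> edge_set n)
  (r : coins P) (fuel : nat) : option (nat * nat) :=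
  exec E r fuel (start P) (fun _ => [::]) 0.

Definition cost_at_most (n k : nat) (P : protocol n k) (B : nat) : Prop :=
  forall (E : 'I_k -> edge_set n) (r : coins P),
    exists fuel out c, run E r fuel = Some (out, c) /\ c <= B.

Definition outputs_good (n k : nat) (P : protocol n k) (E : 'I_k -> edge_set n)
  (good : nat -> Prop) (r : coins P) : Prop :=
  exists fuel out c, run E r fuel = Some (out, c) /\ good out.

(* the private coins of all sites are independent uniform bits;
   success probability >= 99/100, written with counting *)
Definition succeeds_whp (n k : nat) (P : protocol n k) (E : 'I_k -> edge_set n)
  (good : nat -> Prop) : Prop :=
  exists S : {set coins P},
    (forall r, r \in S -> outputs_good E good r) /\
    99 * #|[set: coins P]| <= 100 * #|S|.

(* Main.v *)
(* A deterministic protocol suffices.  Call an edge search the request for an edge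
   of [G] minimizing a given objective; one trip of a token around the ring of sites
   answers it with O(k log n) bits, and the sites all know the next objective because
   it is a function of the previous answers.  With m ~ sqrt n:
   - O(n m) searches reveal, for every vertex, either all its edges or m of them;
   - a greedy hitting set S, of size O(m log n), then meets every neighbourhood of
     which m members are known;
   - O(n |S|) searches, in breadth-first order, make all the distances from S exact.
   On a shortest path of [G], either all edges are known, or some vertex has a
   neighbour in S and a detour through that neighbour costs at most 2.  So the known
   subgraph stretches distances by at most 2, and its diameter is the answer. *)
Require Import Defs.
From mathcomp Require Import all_boot.
From mathcomp Require Import zify.
Set Implicit Arguments. Unset Strict Implicit. Unset Printing Implicit Defensive.

(** * Fixed-length binary codes for finite types *)

Section Code.
Variables (T : finType) (x0 : T) (w : nat).

Definition encode (x : T) : seq bool :=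
  tval (nth [tuple of nseq w false] (enum {: w.-tuple bool}) (enum_rank x)).

Definition decode (b : seq bool) : T :=
  nth x0 (enum T) (find (fun t => tval t == b) (enum {: w.-tuple bool})).

Lemma size_encode x : size (encode x) = w.
Proof. exact: size_tuple. Qed.

Lemma encodeK : #|T| <= 2 ^ w -> cancel encode decode.
Proof.
move=> le_w x; rewrite /decode /encode.
set s := enum {: w.-tuple bool}; set t := nth _ s _.
have lt_s : enum_rank x < size s.
  by rewrite -cardE card_tuple card_bool (leq_trans (ltn_ord _)).
have -> : find (fun u : w.-tuple bool => tval u == tval t) s = index t s.
  by apply: eq_find => u /=; rewrite (inj_eq val_inj).
by rewrite index_uniq ?enum_uniq // nth_enum_rank.
Qed.

End Code.

(** * Minimizers of an objective, and their merging *)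

Section Best.
Variables (A : finType) (b : nat).
Implicit Types (key : A -> nat) (G : {set A}) (o : option A).

(** Keys of at least [b] count as infinite, so [None] certifies that no element of [G] is
    eligible. *)
Definition best key G o : Prop :=
  if o is Some e then [/\ e \in G, key e < b & forall f, f \in G -> key e <= key f]
  else forall f, f \in G -> b <= key f.

Definition choose key G : option A :=
  [pick e in G | (key e < b) && [forall f in G, key e <= key f]].

Definition oset o : {set A} := [set e | o == Some e].

Lemma oset_None : oset None = set0.
Proof. by apply/setP=> e; rewrite !inE. Qed.

Lemma oset_Some e : oset (Some e) = [set e].
Proof. by apply/setP=> f; rewrite !inE eq_sym; apply/eqP/eqP=> [[->]|->]. Qed.

Lemma choose_best key G : best key G (choose key G).
Proof.
rewrite /choose; case: pickP => [e /and3P[eG lt_b /forall_inP]|none] //=.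
move=> f fG; rewrite leqNgt; apply/negP => lt_b.
case: (@arg_minnP _ f (mem G) key fG) => e eG min_e.
have := none e; rewrite /= [e \in G]eG (leq_ltn_trans (min_e f fG) lt_b) /=.
by move/forall_inP; apply=> g /min_e.
Qed.

(** An element of [G] with key below [b] is dominated by the optimum [o], so [o] alone can stand for
    all of [G]. This is why the token carries a single candidate edge. *)
Lemma best_merge key G G' o :
  best key G o -> best key (G' :|: G) (choose key (G' :|: oset o)).
Proof.
move=> bo; have := choose_best key (G' :|: oset o).
have keyG f : f \in G -> (exists2 e, e \in oset o & key e <= key f) \/ b <= key f.
  case: o bo => [e [_ _ min_e] /min_e|/[apply]]; last by right.
  by left; exists e; rewrite // inE.
have sub e : e \in oset o -> e \in G.
  by case: o bo {keyG} => [e' [? _ _]|_]; rewrite inE // => /eqP[<-].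
case: choose => [e [eG lt_b min_e]|none] /=.
  split=> // [|f]; rewrite inE.
    by move: eG; rewrite inE => /orP[->|/sub ->]; rewrite ?orbT.
  case/orP=> [fG|/keyG[[g go]|]].
  - by apply: min_e; rewrite inE fG.
  - by apply: leq_trans; apply: min_e; rewrite inE go orbT.
  - by apply: leq_trans; apply: ltnW.
move=> f; rewrite inE => /orP[fG|/keyG[[g go]|//]].
  by apply: none; rewrite inE fG.
by apply: leq_trans; apply: none; rewrite inE go orbT.
Qed.

End Best.

(** * Edge searches by a token on the ring of sites *)

Notation edge n := ('I_n * 'I_n)%type.

Definition sym_edges n (X : edge_set n) : edge_set n :=
  [set e | (e \in X) || ((e.2, e.1) \in X)].

Definition arcs n (e : rel 'I_n) : edge_set n := [set p | e p.1 p.2].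

(* The token travels [R] times around the ring of sites, and carries the answer
   of the previous round together with the best edge found so far in the
   current one; the answers seen so far determine the objective [key] of the
   round, so no query has to be sent. *)
Section Ring.
Variables (n k' : nat).
Local Notation k := k'.+1.
Local Notation answer := (option (edge n)).
Variables (w R : nat) (key : seq answer -> edge n -> nat) (out : seq answer -> nat).
Hypothesis w_large : #|{: answer * answer}| <= 2 ^ w.

Let enc := encode w (T := (answer * answer)%type).
Let dec := decode (None, None) w (T := (answer * answer)%type).

Definition received (view : seq (event k)) : seq (seq bool) :=
  [seq ev.2 | ev <- view & ~~ ev.1.1].

(** Site [ord0] hears only from the last site, whose second components are the finished answers. Any
    other site reads earlier answers in the first components, the very first of which is a dummy
    [None], hence [behead]. *)
Definition site_state (i : 'I_k) (view : seq (event k)) :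
    seq answer * (answer * answer) :=
  let ms := [seq dec b | b <- received view] in
  if i == ord0 then let h := [seq m.2 | m <- ms] in (h, (last None h, None))
  else (behead [seq m.1 | m <- ms], last (None, None) ms).

Definition site_step (i : 'I_k) (X : edge_set n) (view : seq (event k)) : action k :=
  let: (h, m) := site_state i view in
  if (i == ord0) && (R <= size h) then Halt (out h)
  else Send (ordS i) (enc (m.1, choose n (key h) (sym_edges X :|: oset m.2))).

Definition ring_protocol : protocol n k :=
  @Protocol n k 0 ord0 (fun i X _ view => site_step i X view).

Variable (E : 'I_k -> edge_set n).

Fixpoint partial (kf : edge n -> nat) (i : nat) : answer :=
  if i is j.+1 then choose n kf (sym_edges (E (inord j)) :|: oset (partial kf j))
  else None.

Fixpoint history (r : nat) : seq answer :=
  if r is q.+1 then rcons (history q) (partial (key (history q)) k) else [::].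

Definition reply (r : nat) : answer := partial (key (history r)) k.

Lemma historyE r : history r = mkseq reply r.
Proof. by elim: r => //= r IH; rewrite mkseqS -IH. Qed.

Lemma reply_best r : best n (key (history r)) (arcs (union_adj E)) (reply r).
Proof.
rewrite /reply; move: (key _) => kf.
suff: forall i, i <= k -> best n kf [set e : edge n | [exists j : 'I_k,
    (j < i) && (e \in sym_edges (E j))]] (partial kf i).
  move/(_ k (leqnn _)); congr (best _ _ _ _); apply/setP=> -[u v]; rewrite !inE.
  by apply: eq_existsb => j; rewrite ltn_ord inE.
elim=> [_|i IH lt_ik]; first by move=> f; rewrite inE => /existsP[j].
have := best_merge (sym_edges (E (inord i))) (IH (ltnW lt_ik)).
congr (best _ _ _ _); apply/setP=> e; rewrite !inE.
apply/orP/existsP=> [[eE|/existsP[j /andP[ji eE]]]|[j /andP[]]].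
- by exists (inord i); rewrite inordK // ltnSn inE.
- by exists j; rewrite ltnW.
rewrite ltnS leq_eqVlt => /orP[/eqP <-|ji] eE; last first.
  by right; apply/existsP; exists j; rewrite ji.
by left; move: eE; rewrite inord_val inE.
Qed.

Definition message (r i : nat) : seq bool :=
  enc (last None (history r), partial (key (history r)) i.+1).

Definition prev_site (j : nat) : nat := if j is i.+1 then i else k'.

(* The views when site [i] holds the token in round [r]. *)
Definition consistent (r i : nat) (views : 'I_k -> seq (event k)) : Prop :=
  forall j : 'I_k,
    received (views j) = mkseq (message^~ (prev_site j)) (r + (0 < j <= i)).

Lemma dec_message r i :
  dec (message r i) = (last None (history r), partial (key (history r)) i.+1).
Proof. exact: encodeK. Qed.

Lemma site_state_consistent r (i : 'I_k) views : consistent r i views ->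
  site_state i (views i) =
    (history r, (last None (history r), partial (key (history r)) i)).
Proof.
move=> ok; rewrite /site_state.
have -> : [seq dec b | b <- received (views i)] =
    mkseq (fun q => (last None (history q),
                     partial (key (history q)) (prev_site i).+1)) (r + (0 < i <= i)).
  by rewrite ok -map_comp; apply: eq_map => q; rewrite /= dec_message.
case: eqP => [->|/eqP i_neq0].
  have -> : [seq m.2 | m <- mkseq (fun q => (last None (history q),
      partial (key (history q)) (prev_site (ord0 : 'I_k)).+1)) (r + 0)] = history r.
    by rewrite historyE addn0 -map_comp.
  by [].
have i_gt0 : 0 < i by rewrite lt0n.
have -> : (prev_site i).+1 = i by case: (nat_of_ord i) i_gt0.
rewrite i_gt0 leqnn addn1; congr (_, _); last by rewrite mkseqS last_rcons.
(* Shift by one: the message of round [q.+1] carries the answer to round [q]. *)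
rewrite -map_comp historyE /mkseq /= (iotaDl 1 0) -map_comp.
by apply: eq_map => q /=; rewrite last_rcons.
Qed.

Lemma received_upd (views : 'I_k -> seq (event k)) (i j x : 'I_k) m :
  received (upd_view (upd_view views i (true, j, m)) j (false, i, m) x) =
    if x == j then rcons (received (views x)) m else received (views x).
Proof.
rewrite /received /upd_view; case: (x == j); case: (x == i) => //=;
  by rewrite ?filter_rcons /= ?map_rcons ?filter_rcons.
Qed.

(** The execution invariant: every send uses one unit of fuel and [w.+1] bits, and leaving the
    remaining fuel [f] free lets single moves be chained. *)
Definition reaches (r i : nat) : Prop :=
  exists2 views, consistent r i views &
    forall (c : coins ring_protocol) f,
      run E c (r * k + i + f) =
      exec E c f (inord i) views ((r * k + i) * w.+1).

Lemma reaches_start : reaches 0 0.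
Proof.
exists (fun _ => [::]); first by move=> j; rewrite leqn0; case: (nat_of_ord j).
move=> c f; rewrite /run /=; congr (exec _ _ _ _ _ _).
by apply: val_inj; rewrite /= inordK.
Qed.

Lemma site_step_consistent r (i : 'I_k) views : r < R -> consistent r i views ->
  site_step i (E i) (views i) = Send (ordS i) (message r i).
Proof.
move=> lt_rR ok; rewrite /site_step (site_state_consistent ok).
rewrite historyE size_mkseq leqNgt lt_rR andbF -historyE.
by rewrite /message /= inord_val.
Qed.

Lemma reaches_next r i : r < R -> i < k -> reaches r i ->
  if i == k' then reaches r.+1 0 else reaches r i.+1.
Proof.
move=> lt_rR lt_ik [views ok run_i].
pose i' : 'I_k := inord i; have i'E : i' = i :> nat by rewrite inordK.
pose views' := upd_view (upd_view views i' (true, ordS i', message r i))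
  (ordS i') (false, i', message r i).
have run_next (c : coins ring_protocol) f :
    run E c ((r * k + i).+1 + f) =
    exec E c f (ordS i') views' ((r * k + i).+1 * w.+1).
  have ok' : consistent r i' views by rewrite i'E.
  rewrite addSnnS run_i /= -/i' (site_step_consistent lt_rR ok') i'E.
  by rewrite size_encode mulSn addnC.
have received' j : received (views' j) =
    if j == ordS i' then rcons (received (views j)) (message r i)
    else received (views j) by exact: received_upd.
have [eq_i|neq_i] := eqVneq i k'.
- have ordS0 : ordS i' = ord0 by apply: val_inj; rewrite /= i'E eq_i modnn.
  exists views' => [j|c f]; last first.
    have -> : r.+1 * k + 0 = (r * k + i).+1 by rewrite eq_i mulSn; lia.
    rewrite run_next ordS0; congr (exec _ _ _ _ _ _).
    by apply: val_inj; rewrite /= inordK.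
  rewrite received' ordS0 ok; case: eqVneq => [->|j_neq0].
    by rewrite /= !addn0 mkseqS eq_i.
  have j_gt0 : 0 < j by rewrite lt0n.
  by rewrite j_gt0 eq_i -(ltnS j) ltn_ord addn1 [j <= 0]leqNgt j_gt0 addn0.
- have lt_i : i.+1 < k by rewrite ltnS ltn_neqAle neq_i -ltnS.
  have ordSi : ordS i' = inord i.+1.
    by apply: val_inj; rewrite /= i'E modn_small // inordK.
  exists views' => [j|c f]; last by rewrite addnS run_next ordSi.
  rewrite received' ordSi ok; case: eqVneq => [->|].
    by rewrite inordK //= ltnn leqnn addn0 addn1 mkseqS.
  rewrite -(inj_eq val_inj) /= inordK // => neq_j.
  by rewrite (leq_eqVlt _ i.+1) (negPf neq_j) ltnS.
Qed.

Lemma reaches_end : reaches R 0.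
Proof.
suff: forall r, r <= R -> reaches r 0 by apply.
elim=> [_|r IH lt_rR]; first exact: reaches_start.
have : reaches r k'.
  suff: forall i, i <= k' -> reaches r i by apply.
  elim=> [_|i IHi lt_i]; first exact/IH/ltnW.
  by have := reaches_next lt_rR (ltnW lt_i) (IHi (ltnW lt_i)); rewrite (ltn_eqF lt_i).
by move/(reaches_next lt_rR (ltnSn k')); rewrite eqxx.
Qed.

(** The extra unit of fuel pays for the halting step of [ord0]. *)
Lemma run_ring_protocol (c : coins ring_protocol) :
  run E c (R * k).+1 = Some (out (history R), R * k * w.+1).
Proof.
have [views ok /(_ c 1)] := reaches_end; rewrite addn0 addn1 => ->.
have ord0E : inord 0 = ord0 :> 'I_k by apply: val_inj; rewrite /= inordK.
rewrite /= ord0E /site_step.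
rewrite (site_state_consistent (i := ord0) ok) eqxx.
by rewrite {1}historyE size_mkseq leqnn.
Qed.

End Ring.

(** * Walks, balls and the diameter *)

Section Balls.
Variable n : nat.
Implicit Types (e : rel 'I_n) (s u v : 'I_n) (d : nat).

Fixpoint ball e d s : {set 'I_n} :=
  if d is c.+1 then ball e c s :|: [set v | [exists u in ball e c s, e u v]]
  else [set s].

Lemma ball_walk e d s v : v \in ball e d s <-> walk_le e d s v.
Proof.
split.
  elim: d v => [v /set1P ->|d IH v]; first by exists [::].
  rewrite !inE => /orP[/IH[p [? ? le_d]]|/exists_inP[u /IH[p [ep lp le_d]] euv]].
    by exists p; split; rewrite // leqW.
  by exists (rcons p v); rewrite rcons_path last_rcons size_rcons ep lp.
(* Walks are peeled from their last vertex, since [ball] grows at that end. *)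
case=> p [ep <-]; elim: d p ep => [|d IH] p; elim/last_ind: p => [|p x _] //=.
- by rewrite inE.
- by rewrite size_rcons.
- by move=> _ _; rewrite inE (IH [::]).
rewrite rcons_path size_rcons last_rcons => /andP[ep ex] le_d.
by rewrite !inE; apply/orP; right; apply/exists_inP; exists (last s p); rewrite ?IH.
Qed.

Lemma ball_step e d s u v : u \in ball e d s -> e u v -> v \in ball e d.+1 s.
Proof. by move=> us euv; rewrite !inE; apply/orP/or_intror/exists_inP; exists u. Qed.

Lemma ball_mono e c d s : c <= d -> ball e c s \subset ball e d s.
Proof.
move=> le_cd; apply/subsetP => v /ball_walk[p [? ? le_c]]; apply/ball_walk.
by exists p; split; rewrite // (leq_trans le_c).
Qed.

Lemma ball_sub e e' d s : subrel e e' -> ball e d s \subset ball e' d s.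
Proof.
move=> sub; apply/subsetP => v /ball_walk[p [ep ? ?]]; apply/ball_walk.
by exists p; split; rewrite // (sub_path sub).
Qed.

Lemma walk_cat e c d u v x :
  walk_le e c u v -> walk_le e d v x -> walk_le e (c + d) u x.
Proof.
case=> p [ep <- le_c] [q [eq <- le_d]]; exists (p ++ q).
by rewrite cat_path last_cat size_cat ep eq leq_add.
Qed.

Lemma walk_sym e d u v : symmetric e -> walk_le e d u v -> walk_le e d v u.
Proof.
move=> esym [p [ep <- le_d]]; exists (rev (belast u p)); split.
- by rewrite rev_path (eq_path (e' := e)) // => x y; rewrite esym.
- by case: p {ep le_d} => //= x p; rewrite rev_cons last_rcons.
- by rewrite size_rev size_belast.
Qed.

Lemma walk_short e d u v : walk_le e d u v -> walk_le e n.-1 u v.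
Proof.
case=> p [/shortenP[q eq uq _] lq _]; exists q; split=> //.
have := max_card [in u :: q]; rewrite card_ord (card_uniqP uq) /= => lt_qn.
by rewrite -ltnS (ltn_predK lt_qn).
Qed.

Lemma diameter_lt e D : is_diameter e D -> D < n.
Proof.
case=> all_D [u [v uv]]; have := uv _ (walk_short (all_D u v)).
by case: n u {all_D uv v} e => [[]|].
Qed.

(** Radii up to [n.+1] are tried, which is enough for [D + 2] because a finite diameter [D] is below
    [n]. *)
Definition diam e : nat :=
  find (fun d => [forall u, ball e d u == setT]) (iota 0 n.+2).

(** Radius [D.+2] passes the test of [diam], so the search stops there or earlier. Conversely, walks
    of [e'] are walks of [e], so a pair at distance [D] in [e] is not joined sooner in [e']. *)
Lemma diam_approx e e' D : subrel e' e ->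
    (forall u v, walk_le e D u v -> walk_le e' D.+2 u v) ->
  is_diameter e D -> D <= diam e' <= D + 2.
Proof.
move=> sub approx diamD; have lt_Dn := diameter_lt diamD.
case: diamD => all_D [u [v uv]].
have full d : reflect (forall x y, walk_le e' d x y) [forall x, ball e' d x == setT].
  apply: (iffP forallP) => [ok x y|ok x].
    by apply/ball_walk; rewrite (eqP (ok x)) inE.
  by apply/eqP/setP => y; rewrite inE; apply/ball_walk.
have le_D2 : diam e' <= D + 2.
  rewrite leqNgt; apply/negP => lt_diam.
  have := before_find 0 lt_diam; rewrite nth_iota ?addn2 // => /full [] x y.
  exact/approx/all_D.
rewrite le_D2 andbT; apply: uv.
have has_diam : has (fun d => [forall u, ball e' d u == setT]) (iota 0 n.+2).
  by rewrite has_find size_iota (leq_ltn_trans le_D2) // addn2.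
have := nth_find 0 has_diam; rewrite nth_iota; last first.
  by rewrite -[X in _ < X](size_iota 0) -has_find.
by move/full/(_ u v)=> [p [ep lp le_p]]; exists p; split; rewrite // (sub_path sub).
Qed.

End Balls.

(** * Known subgraphs with additive stretch 2, and the two search objectives *)

Section Spanner.
Variable n : nat.
Implicit Types (K G : edge_set n) (S : {set 'I_n}) (u v w s : 'I_n).

Definition adj K : rel 'I_n := fun u v => (u, v) \in sym_edges K.

Lemma adj_sym K : symmetric (adj K).
Proof. by move=> u v; rewrite /adj !inE orbC. Qed.

Lemma adjS K K' : K \subset K' -> subrel (adj K) (adj K').
Proof.
move=> /subsetP sub u v; rewrite /adj !inE => /orP[] /sub ->; by rewrite ?orbT.
Qed.

Definition nbrs K u : {set 'I_n} := [set v | (u, v) \in K].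

Lemma adj_sub (e : rel 'I_n) K : symmetric e -> K \subset arcs e -> subrel (adj K) e.
Proof.
move=> esym /subsetP sub u v; rewrite /adj inE => /orP[] /sub; rewrite inE //=.
by rewrite esym.
Qed.

(* A shortest path either is known, or passes by a vertex [w] adjacent to some [s]
   in [S]; then going through [s] costs at most [2] more. *)
Lemma detour (e : rel 'I_n) K S d x y : symmetric e ->
    (forall u v, e u v -> (u, v) \notin K -> exists2 s, s \in S & e u s) ->
    (forall s j, s \in S -> j <= n -> ball e j s \subset ball (adj K) j s) ->
  d < n -> walk_le e d x y -> walk_le (adj K) d.+2 x y.
Proof.
move=> esym unknown exact lt_dn [p [ep lp le_d]].
(* The path is split at the first vertex [w] whose next edge is unknown, if there is one. *)
have {ep lp le_d}: walk_le (adj K) d x y \/ exists a b w s,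
    [/\ a + b <= d, walk_le e a x w, walk_le e b w y, s \in S & e w s].
  elim: p x d {lt_dn} ep lp le_d => [|v p IH] x [|d] //=.
  - by move=> _ <- _; left; exists [::].
  - by move=> _ <- _; left; exists [::].
  move=> /andP[exv ep] lp le_d; have [xvK|xvK] := boolP ((x, v) \in K).
    case: (IH v d ep lp le_d) => [|[a [b [w [s [le_ab xw wy sS ws]]]]]].
      case=> q [eq lq le_q]; left; exists (v :: q); split=> //=.
      by rewrite eq andbT /adj inE xvK.
    right; exists a.+1, b, w, s; split=> //; rewrite -add1n.
    by apply: walk_cat xw; exists [:: v]; rewrite /= exv.
  have [s sS xs] := unknown _ _ exv xvK.
  right; exists 0, d.+1, x, s; split=> //; first by exists [::].
  by exists (v :: p); rewrite /= exv.
case=> [[q [? ? le_q]]|[a [b [w [s [le_ab xw wy sS ws]]]]]].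
  by exists q; split; rewrite // (leq_trans le_q) // -addn2 leq_addr.
(* Prefixing the edge from [s] to [w] adds 1, and exactness of the balls around [s] makes the walk a
   known one. Applied to both halves of the path, this costs 2. *)
have via c z : c < n -> walk_le e c w z -> walk_le (adj K) c.+1 s z.
  move=> lt_cn wz; apply/ball_walk/(subsetP (exact s _ sS lt_cn))/ball_walk.
  by rewrite -add1n; apply: walk_cat wz; exists [:: w]; rewrite /= esym ws.
have xs : walk_le (adj K) a.+1 x s.
  by apply/walk_sym/via/walk_sym; rewrite //; [exact: adj_sym | lia].
have sy : walk_le (adj K) b.+1 s y by apply: via => //; lia.
have [q [? ? le_q]] := walk_cat xs sy.
by exists q; split; rewrite // (leq_trans le_q) // addSn addnS.
Qed.

(** The value [n] plays infinity, as searches use the bound [n]. Degrees count recorded orientations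
    only, so a new arc raises just that of its tail. *)
Definition degree_key m K (p : edge n) : nat :=
  if (#|nbrs K p.1| < m) && (p \notin K) then 0 else n.

Definition stretched S K (p : edge n) (l : nat) : bool :=
  [exists s in S, (p.1 \in ball (adj K) l s) && (p.2 \notin ball (adj K) l.+1 s)].

(** The least level at which [p] would be a shortcut from some source; if there is none, [find]
    returns [n], the infinite key. *)
Definition bfs_key S K (p : edge n) : nat := find (stretched S K p) (iota 0 n).

Lemma bfs_key_le S K p l : l < n -> stretched S K p l -> bfs_key S K p <= l.
Proof.
move=> lt_ln st; rewrite leqNgt; apply/negP => lt_l.
by have := before_find 0 lt_l; rewrite nth_iota // st.
Qed.

Lemma bfs_key_stretched S K p : bfs_key S K p < n -> stretched S K p (bfs_key S K p).
Proof.
move=> lt_n; have := nth_find 0 (a := stretched S K p) (s := iota 0 n).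
by rewrite has_find size_iota nth_iota // => /(_ lt_n).
Qed.

(** Induction on the radius: an edge from the ball of radius [j] to a vertex outside the known ball
    of radius [j.+1] would be stretched at level [j], below the lower bound [l] on keys. *)
Lemma bfs_key_exact (e : rel 'I_n) K S l j s : l <= n ->
    (forall p, p \in arcs e -> l <= bfs_key S K p) -> s \in S ->
  j <= l -> ball e j s \subset ball (adj K) j s.
Proof.
move=> le_ln le_key sS; elim: j => // j IH lt_jl.
have sub_j := IH (ltnW lt_jl); apply/subsetP => v /setUP[vj|].
  exact: (subsetP (ball_mono _ _ (leqnSn j))) (subsetP sub_j _ vj).
rewrite inE => /exists_inP[u uj euv]; apply: contraLR lt_jl => vj.
rewrite -leqNgt (leq_trans (le_key (u, v) _)) ?inE //.
have [le_nj|lt_jn] := leqP n j; last first.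
  apply: bfs_key_le => //; apply/exists_inP; exists s => //=.
  by rewrite (subsetP sub_j).
by apply: leq_trans le_nj; rewrite -[leqRHS](size_iota 0) find_size.
Qed.

(** The potential of the second phase: for [K] inside [e], the pairs of a source and a vertex whose
    known distance is the true one. *)
Definition exact_pairs (e : rel 'I_n) S K : {set 'I_n * 'I_n} :=
  [set p | (p.1 \in S) && [forall j : 'I_n.+1,
    (p.2 \in ball e j p.1) ==> (p.2 \in ball (adj K) j p.1)]].

Lemma exact_pairs_le e S K : #|exact_pairs e S K| <= #|S| * n.
Proof.
rewrite -[X in _ * X]card_ord -cardsT -cardsX subset_leq_card //.
by apply/subsetP => p; rewrite !inE andbT => /andP[].
Qed.

(* Breadth-first order: when the shortest stretched edge has level [l], the balls of
   radius at most [l] are exact, so the distance of its new endpoint becomes exact. *)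
Lemma exact_pairs_lt (e : rel 'I_n) S K p : symmetric e -> K \subset arcs e ->
    best n (bfs_key S K) (arcs e) (Some p) ->
  #|exact_pairs e S K| < #|exact_pairs e S (p |: K)|.
Proof.
case: p => u v esym sub [euv lt_ln le_key]; set l := bfs_key _ _ _ in lt_ln le_key.
have [s sS /andP[/= ul vl]] := exists_inP (bfs_key_stretched lt_ln).
have exact j : j <= l -> ball e j s \subset ball (adj K) j s.
  exact: bfs_key_exact (ltnW lt_ln) le_key sS.
have subK : subrel (adj K) (adj ((u, v) |: K)) by apply/adjS/subsetUr.
have vl' : v \in ball (adj ((u, v) |: K)) l.+1 s.
  apply: ball_step (subsetP (ball_sub _ _ subK) _ ul) _.
  by rewrite /adj !inE eqxx.
apply: proper_card; apply/properP; split.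
  apply/subsetP => -[x y]; rewrite !inE /= => /andP[-> /forallP ok] /=.
  apply/forallP => j; apply/implyP => /(implyP (ok j)).
  exact: (subsetP (ball_sub _ _ subK)).
(* The newly exact pair: radii up to [l] were already exact, and larger balls contain [v] through
   the new edge. *)
exists (s, v); rewrite !inE /= sS /=.
  apply/forallP => j; apply/implyP => vj; have [le_jl|lt_lj] := leqP j l.
    exact/(subsetP (ball_sub _ _ subK))/(subsetP (exact _ le_jl)).
  exact: (subsetP (ball_mono _ _ lt_lj)) vl'.
(* Before the insertion, this pair failed at radius [l.+1], which is at most [n]. *)
apply/negP => /forallP /(_ (Ordinal (lt_ln : l.+1 < n.+1)))/implyP H.
case/negP: vl; apply: H; apply: (@ball_step _ _ l _ u);
  last by move: euv; rewrite inE.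
exact: (subsetP (ball_sub _ _ (adj_sub esym sub))).
Qed.

End Spanner.

(** * Greedy hitting sets *)

Section Greedy.
Variables (T : finType) (N : T -> {set T}) (m q : nat).
Hypothesis qm_large : #|T| <= q * m.
Variable W : {set T}.
Hypothesis N_large : forall w, w \in W -> m <= #|N w|.

Definition unhit (S : {set T}) : {set T} := [set w in W | [disjoint N w & S]].

(** Averaging: each unhit set has at least [m] points and [#|T| <= q * m], so some point lies in at
    least a fraction [1/q] of the unhit sets. *)
Lemma greedy_pick (S : {set T}) : unhit S != set0 ->
  exists x, #|unhit S| <= q * #|[set w in unhit S | x \in N w]|.
Proof.
set U := unhit S => U0.
apply/existsP; apply: contraT => /existsPn few.
have count : \sum_x #|[set w in U | x \in N w]| = \sum_(w in U) #|N w|.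
  under eq_bigr do rewrite -sum1dep_card big_mkcondr /=.
  rewrite exchange_big; apply: eq_bigr => w _ /=.
  by rewrite -big_mkcond sum1_card.
have large : #|U| * m <= \sum_(w in U) #|N w|.
  rewrite -sum_nat_const; apply: leq_sum => w.
  by rewrite inE => /andP[/N_large].
have T_gt0 : 0 < #|T| by case/set0Pn: U0 => x _; apply/card_gt0P; exists x.
have small : q * \sum_x #|[set w in U | x \in N w]| < #|T| * #|U|.
  rewrite big_distrr -sum_nat_const /=.
  have [x0 _] := card_gt0P T_gt0.
  rewrite (bigD1 x0) //= [ltnRHS](bigD1 x0) //= -addSn leq_add //.
    by rewrite ltnNge few.
  by apply: leq_sum => x _; rewrite ltnW // ltnNge few.
move: small; rewrite count ltnNge; case/negP.
rewrite (leq_trans (leq_mul qm_large (leqnn _))) //.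
by rewrite -mulnA leq_mul2l mulnC large orbT.
Qed.

(** Each chosen point leaves unhit at most a fraction [(q-1)/q] of the sets; the bound is multiplied
    out to stay in integers. *)
Lemma greedy_hits t : exists2 S : {set T}, #|S| <= t &
  #|unhit S| * q ^ t <= #|W| * q.-1 ^ t.
Proof.
elim: t => [|t [S le_S hits]].
  exists set0; rewrite ?cards0 // !expn0 !muln1 subset_leq_card //.
  by apply/subsetP => w; rewrite inE => /andP[].
have [U0|/greedy_pick[x le_x]] := eqVneq (unhit S) set0.
  by exists S; rewrite ?U0 ?cards0 // leqW.
exists (x |: S); first by rewrite cardsU1 (leq_trans (leq_add (leq_b1 _) le_S)).
have : #|[set w in unhit S | x \in N w]| + #|unhit (x |: S)| <= #|unhit S|.
  rewrite -(cardsID [set w | x \in N w] (unhit S)) leq_add //.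
    by apply/subset_leq_card/subsetP => w; rewrite !inE.
  apply/subset_leq_card/subsetP => w; rewrite !inE => /andP[-> dis] /=.
  rewrite (disjointFl dis) ?setU11 //=.
  by apply: disjointWr dis; apply: subsetUr.
move=> le_U; rewrite !expnSr !mulnA.
have le1 : #|unhit (x |: S)| * q <= #|unhit S| * q.-1.
  by case: (q) le_x le_U => [|q'] /=; nia.
apply: leq_trans (leq_mul hits (leqnn q.-1)).
by rewrite mulnAC [leqRHS]mulnAC leq_mul2r le1 orbT.
Qed.

End Greedy.

(** Two leading terms of the binomial expansion, which yield [(1 - 1/q)^q <= 1/2] next. *)
Lemma exp_succ_ge p j : p ^ j.+1 + j.+1 * p ^ j <= p.+1 ^ j.+1.
Proof.
elim: j => [|j IH]; first by rewrite !expn1 expn0 addn1.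
rewrite [p.+1 ^ _]expnS; apply: leq_trans (leq_mul (leqnn p.+1) IH).
rewrite ![p ^ _.+1]expnS; move: (p ^ j) => x; nia.
Qed.

Lemma double_pred_exp q : 0 < q -> 2 * q.-1 ^ q <= q ^ q.
Proof.
case: q => // p _; apply: leq_trans (exp_succ_ge p p).
by rewrite mul2n -addnn leq_add2l expnS leq_mul2r leqnSn orbT.
Qed.

(* Greedily, [q] more points halve the number of sets not yet hit. *)
Lemma hitting_set (T : finType) (N : T -> {set T}) (m q L : nat) (W : {set T}) :
    0 < q -> #|T| <= q * m -> (forall w, w \in W -> m <= #|N w|) -> #|W| < 2 ^ L ->
  exists2 S : {set T},
    #|S| <= q * L & forall w, w \in W -> exists2 s, s \in S & s \in N w.
Proof.
move=> q_gt0 qm_large N_large W_small.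
have [S le_S hits] := greedy_hits qm_large N_large (q * L); exists S => //.
have halved : 2 ^ L * q.-1 ^ (q * L) <= q ^ (q * L).
  by rewrite !expnM -expnMn; case: L {hits le_S W_small} => // L;
    rewrite leq_exp2r // double_pred_exp.
(* [2 ^ L] times the number of unhit sets is at most [#|W| < 2 ^ L], so that number is 0. *)
have U0 : unhit N W S = set0.
  apply/eqP; rewrite -cards_eq0 -leqn0 -ltnS.
  rewrite -(ltn_pmul2r (_ : 0 < 2 ^ L)) ?expn_gt0 // mul1n.
  apply: leq_ltn_trans W_small.
  rewrite -(leq_pmul2r (_ : 0 < q ^ (q * L))) ?expn_gt0 ?q_gt0 // mulnAC.
  apply: leq_trans (leq_mul hits (leqnn _)) _.
  by rewrite -mulnA leq_mul2l [X in X <= _]mulnC halved orbT.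
move=> w wW; have : w \notin unhit N W S by rewrite U0 inE.
rewrite inE wW /= => /pred0Pn[s /andP[/= ? ?]]; by exists s.
Qed.

(** * Termination of a phase by a potential argument *)

(** Every edge found raises [Phi], bounded by [N], so [N.+1] searches cannot all succeed. After a
    failure the edge set, and hence the search, no longer changes, so failure is permanent. *)
Lemma phase_done n (e : rel 'I_n) (kf : edge_set n -> edge n -> nat)
    (Phi : edge_set n -> nat) N (X : nat -> edge_set n) (a : nat -> option (edge n)) :
    X 0 \subset arcs e ->
    (forall r, r <= N -> X r.+1 = oset (a r) :|: X r) ->
    (forall r, r <= N -> best n (kf (X r)) (arcs e) (a r)) ->
    (forall (K : edge_set n) p, K \subset arcs e -> best n (kf K) (arcs e) (Some p) ->
       Phi K < Phi (p |: K)) ->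
    (forall K, Phi K <= N) ->
  X N.+1 \subset arcs e /\ best n (kf (X N.+1)) (arcs e) None.
Proof.
move=> X0 XS best_a Phi_lt Phi_le.
have sub r : r <= N.+1 -> X r \subset arcs e.
  elim: r => // r IH lt_r; rewrite XS // subUset IH ?(ltnW lt_r) // andbT.
  have := best_a r lt_r; case: (a r) => [p [pe _ _]|_].
    by rewrite oset_Some sub1set.
  by rewrite oset_None sub0set.
split; first exact: sub.
have progress r : r <= N.+1 -> best n (kf (X r)) (arcs e) None \/ r <= Phi (X r).
  elim: r => [|r IH lt_r]; first by right.
  have := best_a r lt_r; rewrite XS //; case: (a r) => [p bp|none].
    have lt_Phi : Phi (X r) < Phi (p |: X r) by apply: Phi_lt; rewrite ?sub // ltnW.
    rewrite oset_Some; case: (IH (ltnW lt_r)) => [none|le_r].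
      by case: bp => pe lt_n _; have := none p pe; rewrite leqNgt lt_n.
    by right; apply: leq_ltn_trans lt_Phi.
  by left; rewrite oset_None set0U.
by case: (progress N.+1 (leqnn _)) => // /leq_trans/(_ (Phi_le _)); rewrite ltnn.
Qed.

(** The potential of the first phase; the cap at [m] bounds it by [n * m]. *)
Definition degree_sum n m (K : edge_set n) : nat := \sum_u minn #|nbrs K u| m.

Lemma degree_sum_le n m (K : edge_set n) : degree_sum m K <= n * m.
Proof.
rewrite -[X in X * _]card_ord -sum_nat_const leq_sum // => u _; exact: geq_minr.
Qed.

Lemma degree_sum_lt n m (e : rel 'I_n) (K : edge_set n) p :
  best n (degree_key m K) (arcs e) (Some p) -> degree_sum m K < degree_sum m (p |: K).
Proof.
case: p => u v [_ + _]; rewrite /degree_key /=; case: ifP => [|_]; last by rewrite ltnn.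
case/andP=> deg_u new _; rewrite /degree_sum (bigD1 u) //= [ltnRHS](bigD1 u) //=.
have nbrs_u : nbrs ((u, v) |: K) u = v |: nbrs K u.
  by apply/setP => x; rewrite !inE xpair_eqE eqxx.
rewrite -addSn leq_add //.
  by rewrite nbrs_u cardsU1 inE new (minn_idPl (ltnW deg_u)) leq_min add1n leqnn.
apply: leq_sum => x _; rewrite leq_min geq_minr andbT.
apply: leq_trans (geq_minl _ _) _; apply/subset_leq_card/subsetP => y.
by rewrite !inE => ->; rewrite orbT.
Qed.

Lemma degree_key_done n m (e : rel 'I_n) (K : edge_set n) u v :
  best n (degree_key m K) (arcs e) None -> e u v -> (u, v) \notin K ->
  m <= #|nbrs K u|.
Proof.
move=> none euv new; have := none (u, v); rewrite inE /degree_key new andbT /=.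
by move/(_ euv); case: ltnP => // _; case: n u {none v euv new e K} => [[]|].
Qed.

(** * The two-phase algorithm and its correctness *)

Section Algorithm.
Variables (n m L : nat).

Definition known (h : seq (option (edge n))) : edge_set n := [set p | Some p \in h].

Definition hits (K : edge_set n) (S : {set 'I_n}) : bool :=
  (#|S| <= m * L) && [forall w, (m <= #|nbrs K w|) ==> [exists s in S, s \in nbrs K w]].

(** A fixed function of the known edges, so all sites agree on the hubs without communication. *)
Definition hubs (K : edge_set n) : {set 'I_n} := odflt set0 [pick S | hits K S].

(** The hubs are computed from the answers of the first phase only, so they stay fixed while the
    second phase reveals edges. *)
Definition search_key (h : seq (option (edge n))) : edge n -> nat :=
  if size h <= n * m then degree_key m (known h)
  else bfs_key (hubs (known (take (n * m).+1 h))) (known h).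

(** Each phase gets one search more than the bound on its potential. *)
Definition rounds : nat := (n * m).+1 + (n * (m * L)).+1.

Lemma hubsP K : 0 < m -> n <= m * m -> n < 2 ^ L -> hits K (hubs K).
Proof.
move=> m_gt0 n_le n_lt; rewrite /hubs; case: pickP => //= none.
have [|w||S le_S hit_S] :=
  @hitting_set _ (nbrs K) m m L [set w | m <= #|nbrs K w|] m_gt0.
- by rewrite card_ord.
- by rewrite inE.
- by apply: leq_ltn_trans n_lt; rewrite -[leqRHS]card_ord max_card.
have := none S; rewrite /hits le_S /=; case/negP; apply/forall_inP => w hw.
by apply/exists_inP; have [|s sS sw] := hit_S w; [rewrite inE | exists s].
Qed.

Lemma algorithm_correct (e : rel 'I_n) (h : nat -> seq (option (edge n)))
    (a : nat -> option (edge n)) D :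
    symmetric e -> 0 < m -> n <= m * m -> n < 2 ^ L ->
    (forall r, h r = mkseq a r) ->
    (forall r, best n (search_key (h r)) (arcs e) (a r)) ->
  is_diameter e D -> D <= diam (adj (known (h rounds))) <= D + 2.
Proof.
move=> esym m_gt0 n_le n_lt hE best_a diamD.
pose X r := known (h r); pose R1 := (n * m).+1.
have XS r : X r.+1 = oset (a r) :|: X r.
  apply/setP => p; rewrite /X !inE !hE mkseqS mem_rcons inE; congr (_ || _).
  exact: eq_sym.
have sizeh r : size (h r) = r by rewrite hE size_mkseq.
have X0 : X 0 \subset arcs e.
  by apply/subsetP => p; rewrite inE hE.
have [sub1 done1] : X R1 \subset arcs e /\
    best n (degree_key m (X R1)) (arcs e) None.
  apply: (@phase_done _ e _ (degree_sum m) _ X a) => // [r le_r|K p _|K].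
  - by have := best_a r; rewrite /search_key sizeh le_r.
  - exact: degree_sum_lt.
  - exact: degree_sum_le.
pose S := hubs (X R1).
have /andP[S_le /forall_inP S_hits] := hubsP (X R1) m_gt0 n_le n_lt.
have [sub2 done2] : X rounds \subset arcs e /\
    best n (bfs_key S (X rounds)) (arcs e) None.
  apply: (@phase_done _ e (bfs_key S) (fun K => #|exact_pairs e S K|) (n * (m * L))
    (fun r => X (R1 + r)) (fun r => a (R1 + r))) => [|r _|r _|K p|K].
  - by rewrite addn0.
  - by rewrite addnS XS.
  - have := best_a (R1 + r); rewrite /search_key sizeh leqNgt leq_addr /=.
    suff -> : take R1 (h (R1 + r)) = h R1 by [].
    by rewrite !hE /mkseq -map_take take_iota (minn_idPl (leq_addr _ _)).
  - exact: exact_pairs_lt.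
  - by apply: leq_trans (exact_pairs_le e S K) _; rewrite mulnC leq_mul2l S_le orbT.
have grow r : X R1 \subset X (R1 + r).
  elim: r => [|r IH]; first by rewrite addn0.
  by rewrite addnS XS subsetU // IH orbT.
apply: (diam_approx _ _ diamD); first exact: adj_sub.
move=> x y; apply: (detour (S := S) esym _ _ (diameter_lt diamD)).
(* An edge unknown at the end was unknown after the first phase, so [u] had [m] known neighbours by
   then, one of them a hub. *)
- move=> u v euv new; have new1 : (u, v) \notin X R1.
    by apply: contra new; apply: (subsetP (grow _)).
  have := S_hits u (degree_key_done done1 euv new1).
  case/exists_inP=> s sS; rewrite inE => /(subsetP sub1); rewrite inE => eus.
  by exists s.
- by move=> s j sS le_jn; apply: (bfs_key_exact (leqnn n) done2 sS).
Qed.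

End Algorithm.

(** * Choice of parameters and the cost bound *)

Lemma ceil_sqrt n : exists m, n <= m * m <= 4 * n.
Proof.
elim: n => [|n [m /andP[le_nm le_mn]]]; first by exists 0.
have [lt_nm|le_mn'] := ltnP n (m * m); first by exists m; apply/andP; split; lia.
(* Here [n = m * m]; the factor 4 absorbs the jump to [m.+1]. *)
by exists m.+1; apply/andP; split; nia.
Qed.

(** With [x = 2 ^ up_log 2 n], the count [(n * n).+1 ^ 2] is at most [(2 * x ^ 2) ^ 2]. *)
Lemma card_messages n : 
  #|{: option (edge n) * option (edge n)}| <= 2 ^ (4 * up_log 2 n + 2).
Proof.
rewrite card_prod !card_option !card_prod !card_ord.
have le_n : n <= 2 ^ up_log 2 n by apply: up_logP.
rewrite expnD mulnC [4 * _]mulnC expnM.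
move: (2 ^ up_log 2 n) le_n (expn_gt0 2 (up_log 2 n)).
move=> x le_n x_gt0; have le1 : (n * n).+1 <= 2 * (x * x) by nia.
by apply: leq_trans (leq_mul le1 le1) _; rewrite !expnS !expn0; nia.
Qed.

Theorem theorem6p11 :
  exists C : nat, forall n k : nat, 2 <= n -> 1 <= k ->
    exists P : protocol n k,
      (exists B, cost_at_most P B /\ B ^ 2 <= C * k ^ 2 * n ^ 3 * (up_log 2 n) ^ 4) /\
      (forall E : 'I_k -> edge_set n,
         succeeds_whp P E
           (fun out => forall D, is_diameter (union_adj E) D -> D <= out <= D + 2)).
Proof.
(* [56 ^ 2 = 28 ^ 2 * 4]: here 28 is 4 from the number of rounds times 7 from the message length,
   and the last 4 comes from [m * m <= 4 * n]. *)
exists (56 ^ 2) => n [|k'] // n_ge2 _.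
have [m /andP[n_le m_le]] := ceil_sqrt n.
have m_gt0 : 0 < m by case: (m) n_le => //; lia.
(* [L] exceeds the logarithm by one because [hubsP] needs the strict bound [n < 2 ^ L]. *)
set ul := up_log 2 n; pose L := ul.+1; pose w := 4 * ul + 2.
have ul_gt0 : 0 < ul by rewrite up_log_gt0.
have n_lt : n < 2 ^ L.
  by apply: leq_ltn_trans (@up_logP 2 n _) _; rewrite // ltn_exp2l.
pose R := rounds n m L.
exists (ring_protocol k' w R (search_key m L) (fun h => diam (adj (known h)))); split.
  exists (R * k'.+1 * w.+1); split=> [E c|].
    exists (R * k'.+1).+1; do 2!eexists.
    by split; first exact: (run_ring_protocol (card_messages n) E c).
  have le_R : R <= 4 * (n * m) * ul by rewrite /R /rounds /L; nia.
  have le_w : w.+1 <= 7 * ul by rewrite /w; lia.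
  apply: (@leq_trans ((4 * (n * m) * ul * k'.+1 * (7 * ul)) ^ 2)).
    by rewrite leq_exp2r // !leq_mul.
  apply: (@leq_trans (28 ^ 2 * k'.+1 ^ 2 * n ^ 2 * ul ^ 4 * (m * m))).
    by rewrite !expnS !expn0; lia.
  apply: leq_trans (leq_mul (leqnn _) m_le) _.
  by rewrite !expnS !expn0; lia.
(* The protocol is deterministic, so every coin outcome is good. *)
move=> E; exists setT; split=> [c _|]; last by rewrite leq_mul2r orbT.
exists (R * k'.+1).+1; do 2!eexists.
split; first exact: (run_ring_protocol (card_messages n) E c).
move=> D; apply: algorithm_correct (n_lt) _ _ => //.
- by move=> u v; apply: eq_existsb => i; rewrite orbC.
- exact: historyE.
- exact: reply_best.
Qed.
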